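(* For any $n\in\mathbb{N}$ and any cardinal number $\kappa>n$: (i) $V_{\mathbb{BZL}}(\mathbf{D}_2^n\oplus\mathbf{D}_2^n)\subsetneq V_{\mathbb{BZL}}(\mathbf{D}_2^n\oplus\mathbf{D}_2\oplus\mathbf{D}_2^n)\subsetneq V_{\mathbb{BZL}}(\mathbf{D}_2^\kappa\oplus\mathbf{D}_2^\kappa)\subseteq V_{\mathbb{BZL}}(\mathbf{D}_2^\kappa\oplus\mathbf{D}_2\oplus\mathbf{D}_2^\kappa)\subseteq\mathbb{DIST}$; (ii) if $\kappa$ is infinite, then $V_{\mathbb{BZL}}(\mathbf{D}_2^n\oplus\mathbf{D}_2^n)\subsetneq V_{\mathbb{BZL}}(\mathbf{D}_2^n\oplus\mathbf{D}_2\oplus\mathbf{D}_2^n)\subsetneq V_{\mathbb{BZL}}(\mathbf{D}_2^\kappa\oplus\mathbf{D}_2^\kappa)=V_{\mathbb{BZL}}(\mathbf{D}_2^\kappa\oplus\mathbf{D}_2\oplus\mathbf{D}_2^\kappa)\subseteq\mathbb{DIST}$; thus we have the following infinite ascending chain of subvarieties of $\mathbb{DIST}$ (with $n\in\mathbb{N}\setminus\{0,1\}$ in what follows): $\mathbb{T}=V_{\mathbb{BZL}}(\mathbf{D}_1)=V_{\mathbb{BZL}}(\mathbf{D}_2^0\oplus\mathbf{D}_2^0)\subsetneq\mathbb{BA}=V_{\mathbb{BZL}}(\mathbf{D}_2)=V_{\mathbb{BZL}}(\mathbf{D}_2^0\oplus\mathbf{D}_2\oplus\mathbf{D}_2^0)\subsetneq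 V_{\mathbb{BZL}}(\mathbf{D}_3)=V_{\mathbb{BZL}}(\mathbf{D}_2^1\oplus\mathbf{D}_2^1)\subsetneq V_{\mathbb{BZL}}(\mathbf{D}_4)=V_{\mathbb{BZL}}(\mathbf{D}_2^1\oplus\mathbf{D}_2\oplus\mathbf{D}_2^1)\subsetneq\dots\subsetneq V_{\mathbb{BZL}}(\mathbf{D}_2^n\oplus\mathbf{D}_2^n)\subsetneq V_{\mathbb{BZL}}(\mathbf{D}_2^n\oplus\mathbf{D}_2\oplus\mathbf{D}_2^n)\subsetneq V_{\mathbb{BZL}}(\mathbf{D}_2^{n+1}\oplus\mathbf{D}_2^{n+1})\subsetneq V_{\mathbb{BZL}}(\mathbf{D}_2^{n+1}\oplus\mathbf{D}_2\oplus\mathbf{D}_2^{n+1})\subsetneq\dots\subsetneq V_{\mathbb{BZL}}(\mathbf{D}_2^{\aleph_0}\oplus\mathbf{D}_2^{\aleph_0})=V_{\mathbb{BZL}}(\mathbf{D}_2^{\aleph_0}\oplus\mathbf{D}_2\oplus\mathbf{D}_2^{\aleph_0})\subseteq\mathbb{DIST}$.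
   Context: A BI-lattice is an algebra $(L,\wedge,\vee,\cdot',0,1)$ such that $(L,\wedge,\vee,0,1)$ is a bounded lattice and $\cdot'$ is order-reversing with $a''=a$. A pseudo-Kleene algebra is a BI-lattice with $a\wedge a'\le b\vee b'$ for all $a,b$. A BZ-lattice is an algebra $(L,\wedge,\vee,\cdot',\cdot^{\sim},0,1)$ such that $(L,\wedge,\vee,\cdot',0,1)$ is a pseudo-Kleene algebra and $\cdot^{\sim}$ is order-reversing with $a\wedge a^{\sim}=0$ and $a\le a^{\sim\sim}=a^{\sim\prime}$ for all $a$; $\mathbb{BZL}$ is the variety of BZ-lattices. A PBZ$^*$-lattice is a BZ-lattice satisfying $(x\wedge x')^{\sim}\approx x^{\sim}\vee x'^{\sim}$ that is paraorthomodular (if $a\le b$ and $a'\wedge b=0$, then $a=b$); PBZ$^*$-lattices form a variety. An antiortholattice is a PBZ$^*$-lattice whose Brouwer complement is trivial, i.e. $0^{\sim}=1$ and $a^{\sim}=0$ for all $a\ne 0$. $V_{\mathbb{BZL}}(\mathbf{A})$ denotes the variety of BZ-lattices generated by $\mathbf{A}$. $\mathbb{DIST}$ is the variety of PBZ$^*$-lattices with distributive lattice reducts, $\mathbb{BA}$ the variety of Boolean algebras, regarded as PBZ$^*$-lattices with $\cdot^{\sim}=\cdot'$, and $\mathbb{T}$ the trivial variety (one-element algebras). $\mathbf{D}_n$ is the $n$-element chain with its unique involution and the trivial Brouwer complement. For bounded lattices, the ordinal sum $\mathbf{L}\oplus\mathbf{M}$ stacks $\mathbf{M}$ on top of $\mathbf{L}$,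 identifying the top of $\mathbf{L}$ with the bottom of $\mathbf{M}$. For a bounded lattice $\mathbf{M}$ with dual $\mathbf{M}^d$ and a BI-lattice $\mathbf{K}$, $\mathbf{M}\oplus\mathbf{K}\oplus\mathbf{M}^d$ is the ordinal sum with the involution that acts as that of $\mathbf{K}$ on $\mathbf{K}$ and interchanges $\mathbf{M}$ and $\mathbf{M}^d$ via the canonical order-reversing bijection; $\mathbf{M}\oplus\mathbf{M}^d$ is the case $\mathbf{K}=\mathbf{D}_1$. For a cardinal $\kappa$, $\mathbf{D}_2^\kappa$ is the Boolean lattice that is the $\kappa$-th power of the two-element chain (self-dual; $\mathbf{D}_2^0\cong\mathbf{D}_1$), and $\mathbf{D}_2^\kappa\oplus\mathbf{D}_2^\kappa$ and $\mathbf{D}_2^\kappa\oplus\mathbf{D}_2\oplus\mathbf{D}_2^\kappa$ are these constructions with $\mathbf{M}=\mathbf{D}_2^\kappa$ and $\mathbf{K}=\mathbf{D}_1$, respectively $\mathbf{K}=\mathbf{D}_2$, endowed with the trivial Brouwer complement; they are distributive antiortholattices. *)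

(* Defs.v *)
From HB Require Import structures.
From mathcomp Require Import all_boot all_order.
From mathcomp Require Import boolp classical_sets functions cardinality.

Set Implicit Arguments.
Unset Strict Implicit.
Unset Printing Implicit Defensive.

Import Order.Theory.

Local Open Scope order_scope.

HB.mixin Record TBLattice_isBILattice d T of Order.TBLattice d T := {
  kcompl : T -> T;
  kcomplK : involutive kcompl;
  kcompl_anti : forall x y : T, x <= y -> kcompl y <= kcompl x
}.

#[short(type="biLatticeType")]
HB.structure Definition BILattice d :=
  { T of Order.TBLattice d T & TBLattice_isBILattice d T }.

Fact kcompl_bot d (K : biLatticeType d) : kcompl (\bot : K) = \top.
Proof. by apply/eqP; rewrite -le1x -{1}(kcomplK \top) kcompl_anti ?le0x. Qed.

Fact kcompl_top d (K : biLatticeType d) : kcompl (\top : K) = \bot.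
Proof. by rewrite -kcompl_bot kcomplK. Qed.

HB.mixin Record BILattice_isPseudoKleene d T of BILattice d T := {
  kcompl_kleene : forall x y : T, x `&` kcompl x <= y `|` kcompl y
}.

#[short(type="pseudoKleeneType")]
HB.structure Definition PseudoKleene d :=
  { T of BILattice d T & BILattice_isPseudoKleene d T }.

HB.mixin Record PseudoKleene_isBZLattice d T of PseudoKleene d T := {
  bcompl : T -> T;
  bcompl_anti : forall x y : T, x <= y -> bcompl y <= bcompl x;
  meet_bcompl : forall x : T, x `&` bcompl x = \bot;
  le_bcompl2 : forall x : T, x <= bcompl (bcompl x);
  bcompl2 : forall x : T, bcompl (bcompl x) = kcompl (bcompl x)
}.

#[short(type="bzLatticeType")]
HB.structure Definition BZLattice d :=
  { T of PseudoKleene d T & PseudoKleene_isBZLattice d T }.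

(* Displays only steer MathComp notations and carry no mathematical content;
   a class therefore ranges over BZ-lattices of every display. *)

Definition bzclass := forall d : Order.disp_t, bzLatticeType d -> Prop.

Definition subclass (K L : bzclass) : Prop :=
  forall d (A : bzLatticeType d), K d A -> L d A.

Definition eqclass (K L : bzclass) : Prop :=
  forall d (A : bzLatticeType d), K d A <-> L d A.

Definition psubclass (K L : bzclass) : Prop :=
  subclass K L /\ ~ subclass L K.

Declare Scope bzclass_scope.
Delimit Scope bzclass_scope with bz.
Bind Scope bzclass_scope with bzclass.

Notation "K '<=v' L" := (subclass K L)
  (at level 70, no associativity) : bzclass_scope.
Notation "K '<v' L" := (psubclass K L)
  (at level 70, no associativity) : bzclass_scope.
Notation "K '=v' L" := (eqclass K L)
  (at level 70, no associativity) : bzclass_scope.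

Inductive bzterm : Type :=
| TVar of nat
| TBot
| TTop
| TMeet of bzterm & bzterm
| TJoin of bzterm & bzterm
| TKcompl of bzterm
| TBcompl of bzterm.

Fixpoint eval d (A : bzLatticeType d) (v : nat -> A) (t : bzterm) : A :=
  match t with
  | TVar i => v i
  | TBot => \bot
  | TTop => \top
  | TMeet s u => eval v s `&` eval v u
  | TJoin s u => eval v s `|` eval v u
  | TKcompl s => kcompl (eval v s)
  | TBcompl s => bcompl (eval v s)
  end.

Definition satisfies d (A : bzLatticeType d) (s t : bzterm) : Prop :=
  forall v : nat -> A, eval v s = eval v t.

Definition is_variety (K : bzclass) : Prop :=
  exists E : bzterm -> bzterm -> Prop,
    forall d (A : bzLatticeType d),
      K d A <-> (forall s t, E s t -> satisfies A s t).

(* Varieties are equational classes, and V_BZL A is the intersection of those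
   containing A. *)
Definition V_BZL d (A : bzLatticeType d) : bzclass :=
  fun _ B => forall K : bzclass, is_variety K -> K _ A -> K _ B.

Lemma V_BZLP d (A : bzLatticeType d) d' (B : bzLatticeType d') :
  V_BZL A B <-> (forall s t, satisfies A s t -> satisfies B s t).
Proof.
split=> [|AB K [E KE] /KE EA]; last by apply/KE => s t /EA /AB.
move=> /(_ (fun d B => forall s t, satisfies A s t -> @satisfies d B s t)).
by apply=> //; exists (satisfies A).
Qed.

Lemma V_BZL_variety d (A : bzLatticeType d) : is_variety (V_BZL A).
Proof. by exists (satisfies A) => d' B; apply: V_BZLP. Qed.

Definition pbz_star d (A : bzLatticeType d) : Prop :=
  (forall x : A, bcompl (x `&` kcompl x) = bcompl x `|` bcompl (kcompl x)) /\
  (forall x y : A, x <= y -> kcompl x `&` y = \bot -> x = y).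

Definition distributive d (A : bzLatticeType d) : Prop :=
  left_distributive (@Order.meet d A) (@Order.join d A).

Definition TRIV : bzclass := fun _ A => forall x y : A, x = y.

Definition BA : bzclass := fun _ A =>
  [/\ distributive A,
      forall x : A, x `&` kcompl x = \bot,
      forall x : A, x `|` kcompl x = \top
    & forall x : A, bcompl x = kcompl x].

Definition DIST : bzclass := fun _ A => pbz_star A /\ distributive A.

Definition triv_bz d (K : pseudoKleeneType d) : Type := K.

Section TrivialBrouwer.
Context d (K : pseudoKleeneType d).

HB.instance Definition _ := PseudoKleene.on (triv_bz K).

Definition triv_bcompl (x : triv_bz K) : triv_bz K :=
  if x == \bot then \top else \bot.

Fact triv_bcompl_anti (x y : triv_bz K) :
  x <= y -> triv_bcompl y <= triv_bcompl x.
Proof.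
rewrite /triv_bcompl => xy; case: (eqVneq x \bot) => [_|x0]; first exact: lex1.
by case: (eqVneq y \bot) xy x0 => // ->; rewrite lex0 => ->.
Qed.

Fact triv_meet_bcompl (x : triv_bz K) : x `&` triv_bcompl x = \bot.
Proof.
by rewrite /triv_bcompl; case: eqP => [->|_]; rewrite ?meet0x ?meetx0.
Qed.

Fact triv_le_bcompl2 (x : triv_bz K) : x <= triv_bcompl (triv_bcompl x).
Proof.
rewrite {2}/triv_bcompl; case: (eqVneq x \bot) => [->|_]; first exact: le0x.
by rewrite /triv_bcompl eqxx lex1.
Qed.

Fact triv_bcompl2 (x : triv_bz K) :
  triv_bcompl (triv_bcompl x) = kcompl (triv_bcompl x).
Proof.
rewrite {2 3}/triv_bcompl; case: (eqVneq x \bot) => _; last first.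
  by rewrite /triv_bcompl eqxx [RHS]kcompl_bot.
rewrite [RHS]kcompl_top /triv_bcompl.
by case: (eqVneq (\top : triv_bz K) \bot).
Qed.

HB.instance Definition _ := PseudoKleene_isBZLattice.Build d (triv_bz K)
  triv_bcompl_anti triv_meet_bcompl triv_le_bcompl2 triv_bcompl2.

End TrivialBrouwer.

(* The n-element chain, for n >= 1; chain 0 is junk equal to chain 1. *)
Definition chain (n : nat) : Type := 'I_n.-1.+1.

Section Chain.
Variable n : nat.

HB.instance Definition _ := Order.Total.copy (chain n) 'I_n.-1.+1.

Fact chain_le0x (x : chain n) : ord0 <= x.
Proof. exact: leq0n. Qed.

Fact chain_lex1 (x : chain n) : x <= ord_max.
Proof. exact: leq_ord. Qed.

HB.instance Definition _ := Order.hasBottom.Build _ (chain n) chain_le0x.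
HB.instance Definition _ := Order.hasTop.Build _ (chain n) chain_lex1.

Definition chain_kcompl (x : chain n) : chain n := rev_ord x.

Fact chain_kcomplK : involutive chain_kcompl.
Proof. exact: rev_ordK. Qed.

Fact chain_kcompl_anti (x y : chain n) :
  x <= y -> chain_kcompl y <= chain_kcompl x.
Proof. by move=> xy; apply: leq_sub2l. Qed.

HB.instance Definition _ := TBLattice_isBILattice.Build _ (chain n)
  chain_kcomplK chain_kcompl_anti.

Fact chain_kleene (x y : chain n) : x `&` kcompl x <= y `|` kcompl y.
Proof.
have [xy|/ltW yx] := leP x y; first by rewrite leIxl // lexU2 ?xy.
by rewrite leIxr // lexU2 // (kcompl_anti _ _ yx) orbT.
Qed.

HB.instance Definition _ := BILattice_isPseudoKleene.Build _ (chain n)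
  chain_kleene.

End Chain.

Definition D (n : nat) : bzLatticeType _ :=
  triv_bz (chain n).

(* A cardinal is given by a type I; bool is the two-element chain and the
   operations on pow2 I are pointwise. *)

Definition pow2 (I : Type) : Type := I -> bool.

Section Pow2.
Variable I : Type.

HB.instance Definition _ := Order.Lattice.copy (pow2 I) (I -> bool).

Fact pow2_le0x (f : pow2 I) : ((fun=> false) : pow2 I) <= f.
Proof. exact/lefP. Qed.

Fact pow2_lex1 (f : pow2 I) : f <= ((fun=> true) : pow2 I).
Proof. by apply/lefP => x; apply: lex1. Qed.

HB.instance Definition _ := Order.hasBottom.Build _ (pow2 I) pow2_le0x.
HB.instance Definition _ := Order.hasTop.Build _ (pow2 I) pow2_lex1.

End Pow2.

(* The ordinal sum of L and M is realised inside the product lattice of L and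
   M: x in L is (x, \bot), y in M is (\top, y), and the top of L and the bottom
   of M both become (\top, \bot). See osum_lowP, osum_upP, osum_low_le_up,
   osum_glue and osum_cover. *)

Section OrdinalSum.
Context d1 d2 (L : tbLatticeType d1) (M : tbLatticeType d2).

Definition osum_pred : {pred L *p M} :=
  [pred u : L *p M | (u.1 == \top) || (u.2 == \bot)].

Record osum := OSum { osum_val : L *p M; osum_valP : osum_val \in osum_pred }.

HB.instance Definition _ := [isSub of osum for osum_val].
HB.instance Definition _ := [Choice of osum by <:].

HB.instance Definition _ :=
  [SubChoice_isSubPOrder of osum by <: with Order.prod_display d1 d2].

Fact osum_meet_subproof (u v : osum) : osum_val u `&` osum_val v \in osum_pred.
Proof.
move: (osum_valP u) (osum_valP v); rewrite !inE /=.
move=> /orP[/eqP->|/eqP->] /orP[/eqP->|/eqP->];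
  by rewrite ?meet1x ?meet0x ?meetx0 ?eqxx ?orbT.
Qed.

Fact osum_join_subproof (u v : osum) : osum_val u `|` osum_val v \in osum_pred.
Proof.
move: (osum_valP u) (osum_valP v); rewrite !inE /=.
move=> /orP[/eqP->|/eqP->] /orP[/eqP->|/eqP->];
  by rewrite ?join1x ?joinx1 ?joinx0 ?eqxx ?orbT.
Qed.

Fact osum_bot_subproof : \bot \in osum_pred.
Proof. by rewrite inE /= eqxx orbT. Qed.

Fact osum_top_subproof : \top \in osum_pred.
Proof. by rewrite inE /= eqxx. Qed.

Definition osum_meet (u v : osum) : osum := OSum (osum_meet_subproof u v).
Definition osum_join (u v : osum) : osum := OSum (osum_join_subproof u v).

Fact osum_lexI (u v w : osum) : (u <= osum_meet v w) = (u <= v) && (u <= w).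
Proof. by rewrite -!Order.le_val /= lexI. Qed.

Fact osum_leUx (u v w : osum) : (osum_join u v <= w) = (u <= w) && (v <= w).
Proof. by rewrite -!Order.le_val /= leUx. Qed.

HB.instance Definition _ := Order.POrder_isMeetSemilattice.Build _ osum
  osum_lexI.
HB.instance Definition _ := Order.POrder_isJoinSemilattice.Build _ osum
  osum_leUx.

Fact osum_le0x (u : osum) : OSum osum_bot_subproof <= u.
Proof. by rewrite -Order.le_val; apply: le0x. Qed.

Fact osum_lex1 (u : osum) : u <= OSum osum_top_subproof.
Proof. by rewrite -Order.le_val; apply: lex1. Qed.

HB.instance Definition _ := Order.hasBottom.Build _ osum osum_le0x.
HB.instance Definition _ := Order.hasTop.Build _ osum osum_lex1.

Fact osum_low_subproof (x : L) : (x, \bot) \in osum_pred.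
Proof. by rewrite inE /= eqxx orbT. Qed.

Fact osum_up_subproof (y : M) : (\top, y) \in osum_pred.
Proof. by rewrite inE /= eqxx. Qed.

Definition osum_low (x : L) : osum := OSum (osum_low_subproof x).
Definition osum_up (y : M) : osum := OSum (osum_up_subproof y).

Lemma osum_lowP (x x' : L) : (osum_low x <= osum_low x') = (x <= x').
Proof. by rewrite -Order.le_val /= leEprod /= lexx andbT. Qed.

Lemma osum_upP (y y' : M) : (osum_up y <= osum_up y') = (y <= y').
Proof. by rewrite -Order.le_val /= leEprod /= lexx. Qed.

Lemma osum_low_le_up (x : L) (y : M) : osum_low x <= osum_up y.
Proof. by rewrite -Order.le_val /= leEprod /= lex1 le0x. Qed.

Lemma osum_glue : osum_low \top = osum_up \bot.
Proof. exact: val_inj. Qed.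

Lemma osum_cover (u : osum) :
  (exists x, u = osum_low x) \/ (exists y, u = osum_up y).
Proof.
case: u => [[x y] xyP]; have := xyP; rewrite inE => /orP[]/= /eqP e; [right|left].
  by exists y; apply: val_inj; rewrite /= e.
by exists x; apply: val_inj; rewrite /= e.
Qed.

End OrdinalSum.

Arguments osum {d1 d2} L M.

(* An element of M + K + M^d is (m, (k, m')) with m in M, k in K and m' in the dual of M; the
   canonical order-reversing bijection between M and its dual is the identity
   of the underlying set, so that (m, (k, m')) is sent to (m', (kcompl k, m)). *)

Definition hsum d1 d2 (M : tbLatticeType d1) (K : tbLatticeType d2) : Type :=
  osum M (osum K M^d).

Section InvolutiveSum.
Context (d1 d2 : Order.disp_t) (M : tbLatticeType d1).

Section Lattice.
Variable K : tbLatticeType d2.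
HB.instance Definition _ := Order.TBLattice.on (hsum M K).

Definition hsum_low (u : hsum M K) : M := (val u).1.
Definition hsum_mid (u : hsum M K) : K := (val (val u).2).1.
Definition hsum_up (u : hsum M K) : M^d := (val (val u).2).2.

Fact hsum_leE (u v : hsum M K) : (u <= v) =
  [&& hsum_low u <= hsum_low v, hsum_mid u <= hsum_mid v
    & hsum_up u <= hsum_up v].
Proof. by rewrite -Order.le_val /= leEprod -Order.le_val /= leEprod. Qed.

Fact hsum_lowI (u v : hsum M K) :
  hsum_low (u `&` v) = hsum_low u `&` hsum_low v.
Proof. by []. Qed.

Fact hsum_lowU (u v : hsum M K) :
  hsum_low (u `|` v) = hsum_low u `|` hsum_low v.
Proof. by []. Qed.

Fact hsum_midI (u v : hsum M K) :
  hsum_mid (u `&` v) = hsum_mid u `&` hsum_mid v.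
Proof. by []. Qed.

Fact hsum_midU (u v : hsum M K) :
  hsum_mid (u `|` v) = hsum_mid u `|` hsum_mid v.
Proof. by []. Qed.

Fact hsum_upI (u v : hsum M K) :
  hsum_up (u `&` v) = hsum_up u `&` hsum_up v.
Proof. by []. Qed.

Fact hsum_upU (u v : hsum M K) :
  hsum_up (u `|` v) = hsum_up u `|` hsum_up v.
Proof. by []. Qed.

Fact hsum_inj (u v : hsum M K) : hsum_low u = hsum_low v ->
  hsum_mid u = hsum_mid v -> hsum_up u = hsum_up v -> u = v.
Proof. by move=> l m r; apply/eqP; rewrite eq_le !hsum_leE l m r !lexx. Qed.

Fact hsumP (u : hsum M K) :
  [/\ hsum_low u = \top \/ hsum_mid u = \bot,
      hsum_low u = \top \/ hsum_up u = \bot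
    & hsum_mid u = \top \/ hsum_up u = \bot].
Proof.
rewrite /hsum_low /hsum_mid /hsum_up.
case: u => [[x [[y z] yzP]] xP] /=.
have xP' : (x == \top) || ((y == \bot) && (z == \bot)) by exact: xP.
have yzP' : (y == \top) || (z == \bot) by exact: yzP.
case/orP: xP' => [/eqP->|/andP[/eqP-> /eqP->]]; last by split; right.
by case/orP: yzP' => /eqP->; split; auto.
Qed.

End Lattice.

Section BI.
Variable K : biLatticeType d2.

Fact hsum_kcompl_subproof1 (u : hsum M K) :
  ((kcompl (hsum_mid u), hsum_low u) : K *p M^d) \in @osum_pred _ _ K M^d.
Proof.
rewrite inE /=; have [[->|->] _ _] := hsumP u; first by rewrite eqxx orbT.
by rewrite kcompl_bot eqxx.
Qed.

Fact hsum_kcompl_subproof2 (u : hsum M K) :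
  ((hsum_up u, OSum (hsum_kcompl_subproof1 u)) : M *p osum K M^d)
    \in @osum_pred _ _ M (osum K M^d).
Proof.
rewrite inE /= -val_eqE /= xpair_eqE.
have [_ [lt|->] [mt|->]] := hsumP u; rewrite ?eqxx // lt mt.
by rewrite kcompl_top !eqxx orbT.
Qed.

Definition hsum_kcompl (u : hsum M K) : hsum M K :=
  OSum (hsum_kcompl_subproof2 u).

Fact hsum_kcomplK : involutive hsum_kcompl.
Proof. by move=> u; apply: hsum_inj; rewrite //= /hsum_mid /= kcomplK. Qed.

Fact hsum_kcompl_anti (u v : hsum M K) :
  u <= v -> hsum_kcompl v <= hsum_kcompl u.
Proof.
rewrite !hsum_leE => /and3P[l m r]; apply/and3P; split=> //.
exact: kcompl_anti.
Qed.

HB.instance Definition _ := TBLattice_isBILattice.Build _ (hsum M K)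
  hsum_kcomplK hsum_kcompl_anti.

End BI.

Section PK.
Variable K : pseudoKleeneType d2.

Fact hsum_kleene (u v : hsum M K) : u `&` kcompl u <= v `|` kcompl v.
Proof.
rewrite hsum_leE !(hsum_lowI, hsum_midI, hsum_upI).
rewrite !(hsum_lowU, hsum_midU, hsum_upU); apply/and3P; split.
- have /= [_ [->|e] _] := hsumP v; first by rewrite join1x lex1.
  have -> : hsum_low (kcompl v) = \top by exact: e.
  by rewrite joinx1 lex1.
- exact: (@kcompl_kleene _ K (hsum_mid u) (hsum_mid v)).
- have /= [_ [e|->] _] := hsumP u; last by rewrite meet0x le0x.
  have -> : hsum_up (kcompl u) = \bot by exact: e.
  by rewrite meetx0 le0x.
Qed.

HB.instance Definition _ := BILattice_isPseudoKleene.Build _ (hsum M K)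
  hsum_kleene.

End PK.

End InvolutiveSum.

Definition D2pow_D2pow (I : Type) : bzLatticeType _ :=
  triv_bz (hsum (pow2 I) (chain 1)).

Definition D2pow_D2_D2pow (I : Type) : bzLatticeType _ :=
  triv_bz (hsum (pow2 I) (chain 2)).

(* [set: I] #<= [set: J] is the existence of an injection from I to J. *)
Definition card_lt (I J : Type) : Prop :=
  ([set: I] #<= [set: J])%card /\ ~ ([set: J] #<= [set: I])%card.

(* Main.v *)
Require Import Defs.
From mathcomp Require Import all_boot all_order.
From mathcomp Require Import boolp classical_sets functions cardinality.
From mathcomp Require Import zify.

(** Write A_I for the sum of two copies of D_2^I, B_I for the sum with D_2
    between them, and A_n, B_n when I has n elements. Membership in V(A) means
    satisfying every identity of A, so inclusions between varieties come from
    homomorphisms: an injective one (V_BZL_subalgebra) or a surjective one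
    (V_BZL_quotient).

    - A_I is a quotient of B_I, by collapsing the middle chain
      (V_BZL_collapse_mid).
    - If J maps onto I plus a point, B_I embeds in A_J, since the middle D_2
      becomes one more coordinate of both powers (V_BZL_option_surj). This
      covers every J with more than n elements when I has n, and also J = I
      when I is infinite, which makes the two varieties equal there.
    - DIST is an equational class: in the presence of distributivity and of the
      identity for the Brouwer complement of x /\ x', paraorthomodularity is
      automatic (distributive_paraorthomodular). It then suffices that B_I
      itself lies in DIST.
    - BA is generated by D_2, by Boole's expansion of terms (BA_V_BZL), and the
      chains D_1, ..., D_4 are isomorphic to A_0, B_0, A_1, B_1
      (chain_threshold).

    Strictness needs identities that count. The elements z = y /\ y' are those
    of the lower half, and since the Brouwer complement is trivial it decides
    whether an element is zero. So there is a term, indep_term k, that is 1 if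
    the k elements z_i = y_i /\ y_i' are nonzero and each is disjoint from the
    join of the previous ones, and 0 otherwise. In A_n and B_n at most n
    coordinates are available, hence indep_term (n+1) = 0 (indep_bound), whereas
    in A_J with J of more than n elements it takes the value 1. If indep_term n
    is 1, the z_i exhaust all n coordinates and their join is the top of the
    lower copy. That element is fixed by the involution in A_n
    (join_term_fills) and lies strictly below its complement in B_n. *)

Set Implicit Arguments.
Unset Strict Implicit.
Unset Printing Implicit Defensive.

Import Order.Theory.

Local Notation hs I e := (hsum (pow2 I) (chain e)).

(** * Varieties and homomorphisms *)

Section Classes.
Local Open Scope order_scope.

Lemma psubclass_eq (K K' L L' : bzclass) :
  eqclass K K' -> eqclass L L' -> psubclass K L -> psubclass K' L'.
Proof.
move=> KK LL [KL LK]; split=> [d A /KK /KL /LL //|LK']; apply: LK => d A /LL.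
by move/LK'/KK.
Qed.

Lemma V_BZL_refl d (A : bzLatticeType d) : V_BZL A A.
Proof. by move=> K _. Qed.

Lemma V_BZL_sub d d' (A : bzLatticeType d) (B : bzLatticeType d') :
  V_BZL B A -> subclass (V_BZL A) (V_BZL B).
Proof. by move=> BA d'' C AC K VK /(BA K VK) /(AC K VK). Qed.

Lemma V_BZL_psub d d' (A : bzLatticeType d) (B : bzLatticeType d') s t :
  V_BZL B A -> satisfies A s t -> ~ satisfies B s t ->
  psubclass (V_BZL A) (V_BZL B).
Proof.
move=> BA As Bs; split; first exact: V_BZL_sub.
by move=> /(_ _ B (V_BZL_refl (A := B))) /V_BZLP /(_ _ _ As).
Qed.

Definition bzhom d d' (A : bzLatticeType d) (B : bzLatticeType d') (f : A -> B) :=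
  [/\ f \bot = \bot,
      {morph f : x y / x `&` y},
      {morph f : x y / x `|` y},
      {morph f : x / kcompl x}
    & {morph f : x / bcompl x}].

Lemma bzhom_eval d d' (A : bzLatticeType d) (B : bzLatticeType d') (f : A -> B)
    (v : nat -> A) t :
  bzhom f -> f (eval v t) = eval (f \o v) t.
Proof.
case=> f0 fI fU fk fb; elim: t => //=.
- by rewrite -kcompl_bot fk f0 kcompl_bot.
- by move=> s IHs t IHt; rewrite fI IHs IHt.
- by move=> s IHs t IHt; rewrite fU IHs IHt.
- by move=> s IHs; rewrite fk IHs.
- by move=> s IHs; rewrite fb IHs.
Qed.

Lemma V_BZL_subalgebra d d' (A : bzLatticeType d) (B : bzLatticeType d')
    (f : A -> B) :
  bzhom f -> injective f -> V_BZL B A.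
Proof.
move=> fh fi; apply/V_BZLP => s t Bst v; apply: fi.
by rewrite !(bzhom_eval _ _ fh).
Qed.

Lemma V_BZL_quotient d d' (A : bzLatticeType d) (B : bzLatticeType d')
    (f : A -> B) :
  bzhom f -> (forall y, exists x, f x = y) -> V_BZL A B.
Proof.
move=> fh /choice[g fg]; apply/V_BZLP => s t Ast v.
have -> : v = f \o (g \o v) by apply/funext => i /=; rewrite fg.
by rewrite -!(bzhom_eval _ _ fh) Ast.
Qed.

(** Under a trivial Brouwer complement, a map of the underlying pseudo-Kleene
    algebras is a homomorphism as soon as only the bottom goes to the bottom.
    A one-element target is the exception, its bottom being its top. *)
Lemma bzhom_triv d d' (K : pseudoKleeneType d) (L : pseudoKleeneType d')
    (f : triv_bz K -> triv_bz L) :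
  f \bot = \bot -> {morph f : x y / x `&` y} -> {morph f : x y / x `|` y} ->
  {morph f : x / kcompl x} ->
  (forall x, f x = \bot -> x = \bot \/ \top = \bot :> L) -> bzhom f.
Proof.
move=> f0 fI fU fk fr; split=> // x; rewrite /bcompl/= /triv_bcompl.
have f1 : f \top = \top by rewrite -kcompl_bot fk f0 kcompl_bot.
case: (eqVneq x \bot) => [->|x0]; first by rewrite f0 eqxx.
rewrite f0; case: eqP => // /fr [e|e]; first by rewrite e eqxx in x0.
exact/esym.
Qed.

End Classes.

(** * Distributive PBZ*-lattices and Boolean algebras as varieties *)

Section Equational.
Local Open Scope order_scope.
Context d (A : bzLatticeType d).

Lemma bcompl_top : bcompl (\top : A) = \bot.
Proof. by rewrite -[LHS]meet1x meet_bcompl. Qed.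

Lemma bcompl_bot : bcompl (\bot : A) = \top.
Proof.
apply/eqP; rewrite -le1x -[leLHS]kcompl_bot -[in leLHS]bcompl_top -bcompl2.
by apply: bcompl_anti; exact: le0x.
Qed.

Lemma bcompl_le_kcompl (x : A) : bcompl x <= kcompl x.
Proof.
by rewrite -[leLHS]kcomplK -bcompl2; apply/kcompl_anti/le_bcompl2.
Qed.

(** If x <= y and x' /\ y = 0, then x /\ x' = 0, so the identity gives
    1 = 0~ = x~ \/ x'~ <= x' \/ x, and y = y /\ (x \/ x') = x follows by
    distributivity. *)
Lemma distributive_paraorthomodular :
  distributive A ->
  (forall x : A, bcompl (x `&` kcompl x) = bcompl x `|` bcompl (kcompl x)) ->
  pbz_star A.
Proof.
move=> dA star; split=> // x y xy xy0.
have xx0 : x `&` kcompl x = \bot.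
  by apply/eqP; rewrite -lex0 -xy0 [leRHS]meetC leI2.
have xx1 : kcompl x `|` x = \top.
  apply/eqP; rewrite -le1x -bcompl_bot -xx0 star leU2 ?bcompl_le_kcompl //.
  by rewrite (le_trans (bcompl_le_kcompl _)) // kcomplK.
apply/esym; rewrite -[LHS]meet1x -xx1 dA xy0 join0x.
exact/meet_l.
Qed.

End Equational.

Section Varieties.
Local Open Scope order_scope.
Context d (A : bzLatticeType d) d' (B : bzLatticeType d').

Let X := TVar 0. Let Y := TVar 1. Let Z := TVar 2.

Lemma V_BZL_distributive : V_BZL A B -> distributive A -> distributive B.
Proof.
move=> /V_BZLP AB dA x y z.
pose s := TMeet (TJoin X Y) Z.
pose t := TJoin (TMeet X Z) (TMeet Y Z).
by have := AB s t (fun v => dA _ _ _) (nth \bot [:: x; y; z]).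
Qed.

Lemma V_BZL_DIST : V_BZL A B -> DIST A -> DIST B.
Proof.
move=> AB [[starA _] dA]; have dB := V_BZL_distributive AB dA.
split=> //; apply: distributive_paraorthomodular => // x.
move/V_BZLP: AB => AB.
pose s := TBcompl (TMeet X (TKcompl X)).
pose t := TJoin (TBcompl X) (TBcompl (TKcompl X)).
by have := AB s t (fun v => starA _) (fun=> x).
Qed.

Lemma V_BZL_BA : V_BZL A B -> BA A -> BA B.
Proof.
move=> AB [dA m0 j1 bk]; have dB := V_BZL_distributive AB dA.
move/V_BZLP: AB => AB; split=> // x.
- exact: (AB (TMeet X (TKcompl X)) TBot (fun v => m0 _) (fun=> x)).
- exact: (AB (TJoin X (TKcompl X)) TTop (fun v => j1 _) (fun=> x)).
- exact: (AB (TBcompl X) (TKcompl X) (fun v => bk _) (fun=> x)).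
Qed.

End Varieties.

Section BooleanTerms.
Local Open Scope order_scope.
Context d (B : bzLatticeType d).
Hypothesis B_BA : BA B.

Let dB : left_distributive (@Order.meet d B) (@Order.join d B).
Proof. by case: B_BA. Qed.

Let meet_kcompl (x : B) : x `&` kcompl x = \bot.
Proof. by case: B_BA. Qed.

Let join_kcompl (x : B) : x `|` kcompl x = \top.
Proof. by case: B_BA. Qed.

(** Agreement below a is a congruence of a Boolean algebra; only the complement
    is not immediate. *)
Lemma BA_kcompl_cong (x y a : B) :
  x `&` a = y `&` a -> kcompl x `&` a = kcompl y `&` a.
Proof.
have sub (u w : B) : u `&` a = w `&` a -> kcompl u `&` a <= kcompl w `&` a.
  move=> uw; rewrite lexI leIr andbT -[leLHS]meet1x -(join_kcompl w) dB leUx leIl.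
  by rewrite meetCA -uw meetA [kcompl u `&` u]meetC meet_kcompl meet0x le0x.
by move=> xy; apply/le_anti; rewrite !sub.
Qed.

Lemma BA_eval_cong (a : B) (v w : nat -> B) t :
  (forall i, v i `&` a = w i `&` a) -> eval v t `&` a = eval w t `&` a.
Proof.
have [_ _ _ bk] := B_BA.
have dup (x y : B) : x `&` y `&` a = (x `&` a) `&` (y `&` a).
  by rewrite meetACA meetxx.
move=> vw; elim: t => //=.
- by move=> s IHs t IHt; rewrite !dup IHs IHt.
- by move=> s IHs t IHt; rewrite !dB IHs IHt.
- by move=> s /BA_kcompl_cong.
- by move=> s; rewrite !bk => /BA_kcompl_cong.
Qed.

Lemma BA_split (x y a : B) :
  x `&` a = y `&` a -> x `&` kcompl a = y `&` kcompl a -> x = y.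
Proof.
move=> e1 e2; rewrite -[LHS]meet1x -[RHS]meet1x -(join_kcompl a) !dB.
by rewrite ![_ `&` x]meetC ![_ `&` y]meetC e1 e2.
Qed.

(** Boole's expansion: v agrees with v[k := 1] below v k, and with v[k := 0]
    below the complement of v k. An equation whose two sides agree under both
    substitutions therefore holds at v. *)
Lemma BA_expansion (s t : bzterm) (v : nat -> B) k :
  (forall b : bool, let w i := if i == k then (if b then \top else \bot) else v i in
     eval w s = eval w t) ->
  eval v s = eval v t.
Proof.
move=> st; apply: (@BA_split _ _ (v k)).
  pose w i := if i == k then \top else v i.
  have vw i : v i `&` v k = w i `&` v k.
    by rewrite /w; case: eqP => // ->; rewrite meetxx meet1x.
  by rewrite !(BA_eval_cong _ vw) (st true).
pose w i := if i == k then \bot else v i.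
have vw i : v i `&` kcompl (v k) = w i `&` kcompl (v k).
  by rewrite /w; case: eqP => // ->; rewrite meet_kcompl meet0x.
by rewrite !(BA_eval_cong _ vw) (st false).
Qed.

End BooleanTerms.

Fixpoint nvars (t : bzterm) : nat :=
  match t with
  | TVar i => i.+1
  | TBot | TTop => 0
  | TMeet s u | TJoin s u => maxn (nvars s) (nvars u)
  | TKcompl s | TBcompl s => nvars s
  end.

Lemma eq_eval d (A : bzLatticeType d) (v w : nat -> A) t :
  (forall i, (i < nvars t)%N -> v i = w i) -> eval v t = eval w t.
Proof.
elim: t => //=; first by move=> i; apply.
1,2: by move=> s IHs t IHt vw; rewrite IHs ?IHt // => i it;
  apply: vw; rewrite leq_max it ?orbT.
all: by move=> s IHs vw; rewrite IHs.
Qed.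

Section TwoElement.
Local Open Scope order_scope.

(** A Boolean algebra satisfies every identity of an algebra in which 0 and 1
    form the two-element Boolean algebra, since by expansion along each
    variable it is enough to check an identity at 0-1 valuations. *)
Lemma BA_V_BZL d (B : bzLatticeType d) d' (A : bzLatticeType d') :
  BA B -> bcompl (\bot : A) = \top -> bcompl (\top : A) = \bot ->
  (\top : A) <> \bot -> V_BZL A B.
Proof.
move=> B_BA A0 A1 A10; apply/V_BZLP => s t Ast v.
have [_ _ _ Bb] := B_BA.
pose c d (C : bzLatticeType d) (b : bool) : C := if b then \top else \bot.
have c_eval u (b : nat -> bool) :
    exists b0, eval (c _ A \o b) u = c _ A b0 /\ eval (c _ B \o b) u = c _ B b0.
  elim: u => /=.
  - by move=> i; exists (b i).
  - by exists false.
  - by exists true.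
  - move=> u [p [-> ->]] w [q [-> ->]]; exists (p && q).
    by case: p; case: q; rewrite /= ?meetxx ?meetx0 ?meet0x.
  - move=> u [p [-> ->]] w [q [-> ->]]; exists (p || q).
    by case: p; case: q; rewrite /= ?joinxx ?joinx0 ?join0x.
  - move=> u [p [-> ->]]; exists (~~ p).
    by case: p; rewrite /= ?kcompl_bot ?kcompl_top.
  - move=> u [p [-> ->]]; exists (~~ p).
    by case: p; rewrite /= !Bb ?A0 ?A1 ?kcompl_bot ?kcompl_top.
have c_st (b : nat -> bool) : eval (c _ B \o b) s = eval (c _ B \o b) t.
  have [p [sA ->]] := c_eval s b; have [q [tA ->]] := c_eval t b.
  have := Ast (c _ A \o b); rewrite sA tA.
  by case: p {sA}; case: q {tA} => //= e; case: A10.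
(* Below, k counts the variables not yet specialised to 0 or 1. *)
have main k w (b : nat -> bool) : (forall i, (k <= i)%N -> w i = c _ B (b i)) ->
    eval w s = eval w t.
  elim: k w b => [|k IH] w b wb.
    by have -> : w = c _ B \o b by apply/funext => i; exact: wb.
  apply: (BA_expansion B_BA (k := k)) => b0 /=.
  apply: (IH _ (fun i => if i == k then b0 else b i)) => i ki.
  by case: eqP => // ik; apply: wb; rewrite ltn_neqAle ki andbT eq_sym; apply/eqP.
pose m := maxn (nvars s) (nvars t).
pose w i := if (i < m)%N then v i else \bot.
have vw u : (nvars u <= m)%N -> eval v u = eval w u.
  by move=> um; apply: eq_eval => i iu; rewrite /w (leq_trans iu um).
rewrite !vw ?leq_maxl ?leq_maxr //; apply: (main m w (fun=> false)) => i mi.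
by rewrite /w ltnNge mi.
Qed.

End TwoElement.

(** * Coordinates on the ordinal sums *)

Section HsumPow2.
Local Open Scope order_scope.
Context (I : Type) d (K : pseudoKleeneType d).
Local Notation H := (hsum (pow2 I) K).
Implicit Types (u v : H) (i : I).

Definition lowb u i : bool := hsum_low u i.

(** The upper coordinate is read in the power of D_2 and not in its dual: it is
    constantly true at the bottom, and meets become disjunctions. *)
Definition upb u i : bool := (hsum_up u : pow2 I) i.

Lemma hsum_ext u v : lowb u =1 lowb v -> hsum_mid u = hsum_mid v ->
  upb u =1 upb v -> u = v.
Proof. by move=> l m r; apply: hsum_inj => //; apply/funext. Qed.

Lemma upb_bot i : upb \bot i = true. Proof. by []. Qed.
Lemma lowbI u v i : lowb (u `&` v) i = lowb u i && lowb v i.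
Proof. by rewrite /lowb hsum_lowI meetfE. Qed.
Lemma lowbU u v i : lowb (u `|` v) i = lowb u i || lowb v i.
Proof. by rewrite /lowb hsum_lowU joinfE. Qed.
Lemma upbI u v i : upb (u `&` v) i = upb u i || upb v i.
Proof. by rewrite /upb hsum_upI; exact: joinfE. Qed.
Lemma upbU u v i : upb (u `|` v) i = upb u i && upb v i.
Proof. by rewrite /upb hsum_upU; exact: meetfE. Qed.
Lemma lowb_kcompl u i : lowb (kcompl u) i = upb u i. Proof. by []. Qed.
Lemma upb_kcompl u i : upb (kcompl u) i = lowb u i. Proof. by []. Qed.
Lemma mid_kcompl u : hsum_mid (kcompl u) = kcompl (hsum_mid u). Proof. by []. Qed.

Lemma hsum_pow2P u :
  [/\ (forall i, lowb u i) \/ hsum_mid u = \bot,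
      (forall i, lowb u i) \/ (forall i, upb u i)
    & hsum_mid u = \top \/ (forall i, upb u i)].
Proof.
have upT : hsum_up u = \bot -> forall i, upb u i by move=> e i; rewrite /upb e.
have lowT : hsum_low u = \top -> forall i, lowb u i by move=> e i; rewrite /lowb e.
by have [[/lowT l|m] [/lowT l'|/upT r] [m'|/upT r']] := hsumP u; split; auto.
Qed.

(** Coordinates of an element of the sum: each leaves its bottom only when the
    lower ones are at their top. *)
Definition hsum_ok (l : pow2 I) (m : K) (r : pow2 I) : Prop :=
  [/\ (forall i, l i) \/ m = \bot,
      (forall i, l i) \/ (forall i, r i)
    & m = \top \/ (forall i, r i)].

Lemma hsum_of (l : pow2 I) (m : K) (r : pow2 I) : hsum_ok l m r ->
  exists u : H, [/\ lowb u = l, hsum_mid u = m & upb u = r].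
Proof.
have allT (f : pow2 I) : (forall i, f i) -> f = (fun=> true).
  by move=> fT; apply/funext => i; rewrite fT.
case=> lm lr mr.
have P1 : ((m, r) : K *p (pow2 I)^d) \in @osum_pred _ _ K (pow2 I)^d.
  by rewrite inE /=; case: mr => [->|/allT ->]; rewrite eqxx ?orbT.
have P2 : ((l, OSum P1) : pow2 I *p osum K (pow2 I)^d) \in
    @osum_pred _ _ (pow2 I) (osum K (pow2 I)^d).
  rewrite inE /= -val_eqE /= xpair_eqE.
  case: lr => [/allT ->|/allT r1]; first by rewrite eqxx.
  case: lm => [/allT ->|->]; first by rewrite eqxx.
  by rewrite r1 !eqxx orbT.
by exists (OSum P2).
Qed.

End HsumPow2.

(** * Homomorphisms into ordinal sums *)

Section Chains.
Local Open Scope order_scope.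
Context (e : nat).
Implicit Types x y : chain e.

Lemma chain_meet x y : x `&` y = minn x y :> nat.
Proof.
rewrite meetEtotal; case: leP => [xy|/ltW yx]; apply/esym; first exact/minn_idPl.
exact/minn_idPr.
Qed.

Lemma chain_join x y : x `|` y = maxn x y :> nat.
Proof.
rewrite joinEtotal; case: leP => [xy|/ltW yx]; apply/esym; first exact/maxn_idPr.
exact/maxn_idPl.
Qed.

Lemma chain_kcomplE x : kcompl x = (e.-1 - x)%N :> nat.
Proof. exact: subSS. Qed.

Lemma chain_meet_kcompl x : (e <= 2)%N -> x `&` kcompl x = \bot.
Proof.
move=> e2; apply/val_inj; change (x `&` kcompl x = 0 :> nat).
rewrite chain_meet chain_kcomplE; have := ltn_ord x; lia.
Qed.

End Chains.

Lemma chain1 (x y : chain 1) : x = y.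
Proof. by rewrite [x]ord1 [y]ord1. Qed.

Section Homs.
Local Open Scope order_scope.

Lemma kcomplI d (K : biLatticeType d) (x y : K) :
  kcompl (x `&` y) = kcompl x `|` kcompl y.
Proof.
apply/le_anti; rewrite leUx !kcompl_anti ?leIl ?leIr // !andbT.
have swap (p q : K) : kcompl p <= q -> kcompl q <= p.
  by move=> /kcompl_anti; rewrite kcomplK.
by apply: (swap); rewrite lexI; apply/andP; split; apply: (swap);
  rewrite ?leUl ?leUr.
Qed.

Lemma kcomplU d (K : biLatticeType d) (x y : K) :
  kcompl (x `|` y) = kcompl x `&` kcompl y.
Proof. by rewrite -[RHS]kcomplK kcomplI !kcomplK. Qed.

(** The upper coordinate of a homomorphism into an ordinal sum is its lower
    coordinate after the involution, so a homomorphism is a family lo of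
    lattice morphisms to the two-element chain with a morphism mi to K. *)
Lemma hsum_hom d (A : pseudoKleeneType d) (I : Type) d' (K : pseudoKleeneType d')
    (lo : I -> A -> bool) (mi : A -> K) :
  (forall i, lo i \bot = false) ->
  (forall i, lo i \top = true) ->
  (forall i x y, lo i (x `&` y) = lo i x && lo i y) ->
  (forall i x y, lo i (x `|` y) = lo i x || lo i y) ->
  mi \bot = \bot -> {morph mi : x y / x `&` y} -> {morph mi : x y / x `|` y} ->
  {morph mi : x / kcompl x} ->
  (forall a, hsum_ok (lo ^~ a) (mi a) (lo ^~ (kcompl a))) ->
  (forall a, (forall i, lo i a = false) -> (forall i, lo i (kcompl a)) ->
     mi a = \bot -> a = \bot \/ \top = \bot :> hsum (pow2 I) K) ->
  exists f : triv_bz A -> triv_bz (hsum (pow2 I) K), bzhom f /\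
    forall a, [/\ lowb (f a) = lo ^~ a, hsum_mid (f a) = mi a
                & upb (f a) = lo ^~ (kcompl a)].
Proof.
move=> lo0 lo1 loI loU mi0 miI miU mik ok refl.
have /choice[f fP] a := hsum_of (ok a).
have fl a i : lowb (f a) i = lo i a by have [->] := fP a.
have fm a : hsum_mid (f a) = mi a by have [] := fP a.
have fu a i : upb (f a) i = lo i (kcompl a) by have [_ _ ->] := fP a.
exists f; split=> //; apply: bzhom_triv.
- apply: hsum_ext => [i||i]; rewrite ?fl ?fm ?fu //.
  by rewrite kcompl_bot lo1.
- move=> x y; apply: hsum_ext => [i||i]; rewrite ?fl ?fm ?fu.
  + by rewrite lowbI !fl loI.
  + by rewrite hsum_midI !fm miI.
  + by rewrite upbI !fu kcomplI loU.
- move=> x y; apply: hsum_ext => [i||i]; rewrite ?fl ?fm ?fu.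
  + by rewrite lowbU !fl loU.
  + by rewrite hsum_midU !fm miU.
  + by rewrite upbU !fu kcomplU loI.
- move=> x; apply: hsum_ext => [i||i]; rewrite ?fl ?fm ?fu.
  + by rewrite lowb_kcompl fu.
  + by rewrite mid_kcompl fm.
  + by rewrite upb_kcompl fl kcomplK.
- move=> x x0; apply: refl => [i|i|]; [rewrite -fl|rewrite -fu|rewrite -fm];
  by rewrite x0.
Qed.

(** Identifying the two points of the middle chain loses only the distinction
    between two elements that are both nonzero, unless I is empty; in that case
    the target has one element. *)
Lemma V_BZL_collapse_mid (I : Type) :
  V_BZL (D2pow_D2_D2pow I) (D2pow_D2pow I).
Proof.
have [||||||||||f [fh fP]] := @hsum_hom _ (hs I 2) I _ (chain 1)
  (fun i u => lowb u i) (fun=> \bot).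
- by [].
- by [].
- by move=> i x y; rewrite lowbI.
- by move=> i x y; rewrite lowbU.
- by [].
- by move=> x y; exact: chain1.
- by move=> x y; exact: chain1.
- by move=> x; exact: chain1.
- move=> u; split; [by right| |by left; exact: chain1].
  by have [_ lu _] := hsum_pow2P u.
- move=> u l0 r1 _; have [[i _]|noI] := pselect (exists i : I, True).
    left; apply: hsum_ext => [j||j]; [by rewrite l0| |by rewrite [LHS]r1].
    by have [[lT|//] _ _] := hsum_pow2P u; have := lT i; rewrite l0.
  right; apply: hsum_ext => [i||i]; last 1 first.
  + by case: noI; exists i.
  + by case: noI; exists i.
  + exact: chain1.
apply: (V_BZL_quotient fh) => y.
(* A preimage of y: the midpoint lifts to the upper point of the middle chain. *)
have [|u [ul um uu]] := @hsum_of I _ (chain 2) (lowb y)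
    (if `[< forall i, lowb y i >] then \top else \bot) (upb y).
  have [_ lr _] := hsum_pow2P y; split=> //.
    by case: asboolP => [lT|_]; [left|right].
  by case: asboolP => [lT|lF]; [left|case: lr => // rT; right].
exists u; have [fl fm fu] := fP u.
apply: hsum_ext => [i||i]; last 1 first.
- by rewrite fu lowb_kcompl uu.
- by rewrite fl ul.
- exact: chain1.
Qed.

(** The chain D_2 sits on top of the lower copy of the power of D_2 indexed by I
    as a further coordinate, so a surjection onto I plus a point embeds both
    halves of the sum with middle D_2 into a sum without middle. The midpoint
    of the target is missed. *)
Lemma V_BZL_option_surj (I J : Type) (g : J -> option I) :
  (forall o, exists j, g j = o) ->
  V_BZL (D2pow_D2pow J) (D2pow_D2_D2pow I).
Proof.
move=> gs.
pose lo (u : hs I 2) (o : option I) : bool :=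
  if o is Some i then lowb u i else (0 < hsum_mid u)%N.
have midk (m : chain 2) : (0 < kcompl m)%N = ~~ (0 < m)%N.
  rewrite chain_kcomplE; have := ltn_ord m; rewrite /=; lia.
have loP u v : lo u =1 lo v -> lo (kcompl u) =1 lo (kcompl v) -> u = v.
  move=> uv uv'; apply: hsum_ext => [i||i]; [exact: (uv (Some i))| |].
    apply/val_inj; move: (uv None) (ltn_ord (hsum_mid u)) (ltn_ord (hsum_mid v)).
    rewrite /lo /=; case: (hsum_mid u) => [[|[]]//= _]; by case: (hsum_mid v) => [[|[]]].
  exact: (uv' (Some i)).
have [||||||||||f [fh fP]] := @hsum_hom _ (hs I 2) J _ (chain 1)
  (fun j u => lo u (g j)) (fun=> \bot).
- by move=> j; case: (g j).
- by move=> j; case: (g j).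
- move=> j x y; rewrite /lo; case: (g j) => [i|]; first by rewrite lowbI.
  by rewrite hsum_midI chain_meet leq_min.
- move=> j x y; rewrite /lo; case: (g j) => [i|]; first by rewrite lowbU.
  by rewrite hsum_midU chain_join leq_max.
- by [].
- by move=> x y; exact: chain1.
- by move=> x y; exact: chain1.
- by move=> x; exact: chain1.
- move=> u; split; [by right| |by left; exact: chain1].
  have [lm lr mr] := hsum_pow2P u.
  have [m0|m0] := boolP (0 < hsum_mid u)%N.
    left=> j; rewrite /lo; case: (g j) => // i; case: lm => // mE.
    by rewrite mE in m0.
  right=> j; rewrite /lo; case: (g j) => [i|]; last by rewrite mid_kcompl midk.
  by rewrite lowb_kcompl; case: mr => // mE; rewrite mE in m0.
- move=> u l0 r1 _; left; apply: loP => o; have [j <-] := gs o.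
    by rewrite l0; case: (g j).
  by rewrite r1; case: (g j).
apply: (V_BZL_subalgebra fh) => u v uv.
have [fl _ fu] := fP u; have [fl' _ fu'] := fP v.
apply: loP => o; have [j <-] := gs o.
  by have := congr1 (@^~ j) fl; rewrite uv fl'.
by have := congr1 (@^~ j) fu; rewrite uv fu'.
Qed.

End Homs.

(** * Chains with at most four elements *)

Section SmallChains.
Local Open Scope order_scope.
Variables n b : nat.
Local Notation C := (chain (n.*2 + b.+1)).
Local Notation H := (hsum (pow2 'I_n) (chain b.+1)).

(** Thresholds embed the chain with 2n+b+1 elements: climbing it fills the lower
    power of D_2 one coordinate at a time, then the middle chain, then the
    upper power. For n <= 1 nothing is missed, as both powers are chains. *)
Lemma chain_threshold : exists f : triv_bz C -> triv_bz H,
  [/\ bzhom f, injective f & (n <= 1)%N -> forall y, exists x, f x = y].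
Proof.
have lt_C (a : C) : (a <= n.*2 + b)%N by have := ltn_ord a; rewrite /=; lia.
have kC (a : C) : kcompl a = (n.*2 + b - a)%N :> nat.
  by rewrite chain_kcomplE; congr (_ - _)%N; lia.
pose mi (a : C) : chain b.+1 := inord (minn (a - n) b).
have miE a : mi a = minn (a - n) b :> nat by rewrite inordK // ltnS geq_minr.
have lt_m (m : chain b.+1) : (m <= b)%N by rewrite -ltnS ltn_ord.
have [||||||||||f [fh fP]] := @hsum_hom _ C 'I_n _ (chain b.+1)
  (fun i a => (i < a)%N) mi.
- by [].
- by move=> i; rewrite -kcompl_bot kC /=; have := ltn_ord i; lia.
- by move=> i x y; rewrite chain_meet leq_min.
- by move=> i x y; rewrite chain_join leq_max.
- by apply/ord_inj; rewrite [LHS]miE /= sub0n min0n.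
- by move=> x y; apply/ord_inj; rewrite chain_meet !miE chain_meet; lia.
- by move=> x y; apply/ord_inj; rewrite chain_join !miE chain_join; lia.
- move=> x; apply/ord_inj; rewrite chain_kcomplE !miE kC /=.
  by have := lt_C x; lia.
- move=> a; split.
  + have [na|an] := leqP n a.
      by left=> i; apply: leq_trans (ltn_ord i) na.
    by right; apply/ord_inj; rewrite miE /=; lia.
  + have [na|an] := leqP n a.
      by left=> i; apply: leq_trans (ltn_ord i) na.
    by right=> i; rewrite kC; have := ltn_ord i; lia.
  + have [na|an] := leqP (n + b) a.
      by left; apply/ord_inj; rewrite miE /=; lia.
    by right=> i; rewrite kC; have := ltn_ord i; lia.
- move=> a lo0 _ mi0; left; apply/val_inj; rewrite /=.
  have {}mi0 : minn (a - n) b = 0%N by rewrite -miE mi0.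
  have [n0|n0] := posnP n; first by have := lt_C a; lia.
  by have := lo0 (Ordinal n0); rewrite /= lt0n; case: eqP.
exists f; split=> // [x y xy|n1 y].
- have [fl fm fu] := fP x; have [fl' fm' fu'] := fP y.
  have l i : (i < n)%N -> (i < x)%N = (i < y)%N.
    by move=> i_n; have := congr1 (@^~ (Ordinal i_n)) fl; rewrite xy fl'.
  have m : minn (x - n) b = minn (y - n) b by rewrite -!miE -fm xy fm'.
  have u i : (i < n)%N -> (i < n.*2 + b - x)%N = (i < n.*2 + b - y)%N.
    move=> i_n; have := congr1 (@^~ (Ordinal i_n)) fu.
    by rewrite xy fu' !kC.
  have {xy fl fm fu fl' fm' fu'} := (lt_C x, lt_C y) => -[xC yC].
  (* For y < x: coordinate y of the lower power separates them if y < n, and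
     coordinate 2n + b - x of the upper power if n + b < x; otherwise both lie
     in the middle chain. *)
  apply/val_inj => /=; apply/eqP; rewrite eqn_leq; apply/andP; split; rewrite leqNgt.
    apply/negP => yx; have := l y; have := u (n.*2 + b - x)%N; lia.
  apply/negP => xy; have := l x; have := u (n.*2 + b - y)%N; lia.
- suff [a [al am au]] : exists a : C, [/\ forall i : 'I_n, lowb y i = (i < a)%N,
      hsum_mid y = minn (a - n) b :> nat
    & forall i : 'I_n, upb y i = (i < kcompl a)%N].
    exists a; have [fl fm fu] := fP a.
    apply: hsum_ext => [i||i]; rewrite ?fl ?fm ?fu ?al ?au //.
    by apply/ord_inj; rewrite miE am.
  have [lm lr mr] := hsum_pow2P y; have mb := lt_m (hsum_mid y).
  have [n0|n0] := posnP n.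
    have no (i : 'I_n) : False by have := ltn_ord i; rewrite {2}n0.
    have aP : (hsum_mid y < (n.*2 + b.+1).-1.+1)%N by lia.
    exists (Ordinal aP); split=> [i||i]; [case: (no i)| |case: (no i)].
    change (hsum_mid y = minn (hsum_mid y - n) b :> nat); lia.
  have {n1} n1 : n = 1%N by lia.
  pose o : 'I_n := Ordinal n0.
  have oP (i : 'I_n) : i = o.
    by apply/val_inj => /=; have := ltn_ord i; rewrite {2}n1; case: (i : nat).
  have L0 : lowb y o = false -> upb y o = true /\ hsum_mid y = 0%N :> nat.
    move=> lo; split; first by case: lr => [/(_ o)|->]; rewrite ?lo.
    by case: lm => [/(_ o)|->]; rewrite ?lo.
  have U0 : upb y o = false -> hsum_mid y = b :> nat.
    by move=> uo; case: mr => [->//|/(_ o)]; rewrite uo.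
  have : exists a, [/\ (a <= n.*2 + b)%N, lowb y o = (0 < a)%N,
      hsum_mid y = minn (a - n) b :> nat & upb y o = (0 < n.*2 + b - a)%N].
    move: mb L0 U0; move: (lowb y o) (upb y o) (nat_of_ord (hsum_mid y)) => L U m.
    rewrite n1 => mb L0 U0.
    exists (if ~~ L then 0 else if ~~ U then 2 + b else 1 + m)%N.
    by case: L L0 => L0; case: U L0 U0 => L0 U0 /=; split; lia.
  case=> a [aC la ma ua]; have aP : (a < (n.*2 + b.+1).-1.+1)%N by lia.
  exists (Ordinal aP); rewrite kC.
  by split=> [i||i]; [rewrite (oP i)| |rewrite (oP i)].
Qed.

End SmallChains.

(** The case n = 0, 1 and b = 0, 1 gives D_1, D_2, D_3 and D_4. *)
Lemma V_BZL_small_chain n b : (n <= 1)%N ->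
  eqclass (V_BZL (D (n.*2 + b.+1)))
          (V_BZL (triv_bz (hsum (pow2 'I_n) (chain b.+1)))).
Proof.
move=> n1; have [f [fh fi /(_ n1) fs]] := chain_threshold n b.
by split; apply: V_BZL_sub; [apply: V_BZL_subalgebra fi|apply: V_BZL_quotient fs].
Qed.

(** * Membership in DIST, BA and T *)

Section HsumProps.
Local Open Scope order_scope.

Lemma hsum_distr I e :
  left_distributive (@Order.meet _ (hs I e)) (@Order.join _ (hs I e)).
Proof.
move=> x y z; apply: hsum_ext => [i||i].
- by rewrite lowbI !lowbU !lowbI andb_orl.
- by rewrite hsum_midI !hsum_midU !hsum_midI meetUl.
- by rewrite upbI !upbU !upbI orb_andl.
Qed.

Lemma chain2P (m : chain 2) : m = \bot \/ m = \top.
Proof. by case: m => [[|[|//]] mP]; [left|right]; apply/val_inj. Qed.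

(** An element of the lower half lies below its complement, and one of the upper
    half above it; so the meet is one of the two. *)
Lemma hsum2_meet_kcompl I (u : hs I 2) :
  u `&` kcompl u = \bot -> u = \bot \/ kcompl u = \bot.
Proof.
move=> u0.
have lr i : lowb u i && upb u i = false.
  by have := congr1 (fun w => lowb w i) u0; rewrite /= lowbI lowb_kcompl.
have [lm _ mr] := hsum_pow2P u; have [m0|m1] := chain2P (hsum_mid u).
- have rT : forall i, upb u i by case: mr => //; rewrite m0 => /(congr1 val).
  left; apply: hsum_ext => [i||i] //; last by rewrite rT.
  by have := lr i; rewrite rT andbT => ->.
- have lT : forall i, lowb u i by case: lm => //; rewrite m1 => /(congr1 val).
  right; apply: hsum_ext => [i||i].
  + by rewrite lowb_kcompl; have := lr i; rewrite lT /= => ->.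
  + by rewrite mid_kcompl m1 kcompl_top.
  + by rewrite upb_kcompl lT.
Qed.

Lemma D2pow_D2_D2pow_DIST I : DIST (D2pow_D2_D2pow I).
Proof.
have dH : distributive (D2pow_D2_D2pow I) by exact: (@hsum_distr I 2).
split=> //; apply: distributive_paraorthomodular => // x.
rewrite [LHS]/bcompl/= {1}/triv_bcompl; case: eqP => [/hsum2_meet_kcompl|x0].
  case=> ->; rewrite bcompl_bot; first by rewrite join1x.
  by rewrite joinx1.
rewrite /bcompl/= /triv_bcompl; case: eqP => [xE|_].
  by case: x0; rewrite xE meet0x.
case: eqP => [xE|_]; last by rewrite joinxx.
by case: x0; rewrite xE meetx0.
Qed.

Lemma D_2_BA : BA (D 2).
Proof.
have k (x : chain 2) : x `&` kcompl x = \bot by exact: chain_meet_kcompl.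
split.
- by move=> x y z; exact: (@meetUl _ (chain 2)).
- exact: k.
- by move=> x; rewrite -[LHS]kcomplK kcomplU [X in kcompl X]k kcompl_bot.
- by move=> x; case: (chain2P x) => ->; rewrite ?kcompl_bot ?kcompl_top
    ?bcompl_bot ?bcompl_top.
Qed.

Lemma BA_D2 : eqclass BA (V_BZL (D 2)).
Proof.
split=> [B_BA|AB]; last exact: V_BZL_BA D_2_BA.
by apply: BA_V_BZL; rewrite ?bcompl_bot ?bcompl_top // => /(congr1 val).
Qed.

Lemma TRIV_D1 : eqclass TRIV (V_BZL (D 1)).
Proof.
move=> d A; rewrite V_BZLP; split=> [A1 s t _ v|D1A x y]; first exact: A1.
apply: (D1A (TVar 0) (TVar 1) _ (nth x [:: x; y])) => v.
exact: (@chain1 (v 0) (v 1)).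
Qed.

End HsumProps.

(** * Separating identities *)

Section SeparatingTerms.
Local Open Scope order_scope.

(** In a sum with at most two points in the middle, x /\ x' ranges over the
    lower power of D_2. *)
Definition half_term (i : nat) : bzterm := TMeet (TVar i) (TKcompl (TVar i)).

Fixpoint join_term (k : nat) : bzterm :=
  if k is k'.+1 then TJoin (join_term k') (half_term k') else TBot.

(** Under a trivial Brouwer complement, x~ is 1 or 0 according to whether x is
    zero, and x~~ is 1 or 0 according to whether x is nonzero; so this term says
    that the first k half terms are nonzero and disjoint. *)
Fixpoint indep_term (k : nat) : bzterm :=
  if k is k'.+1 then
    TMeet (indep_term k')
      (TMeet (TBcompl (TMeet (join_term k') (half_term k')))
             (TBcompl (TBcompl (half_term k'))))
  else TTop.

Section Bound.
Variables (n e : nat).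
Hypothesis e2 : (e <= 2)%N.
Variable v : nat -> triv_bz (hs 'I_n e).

Let low t : {set 'I_n} := [set i | lowb (eval v t) i]%SET.

(** Each new half term is nonzero and disjoint from the join of the previous
    ones, so it adds a coordinate to the support. *)
Lemma card_join_term k :
  eval v (indep_term k) <> \bot -> (k <= #|low (join_term k)|)%N.
Proof.
elim: k => [//|k IH] /= C.
have C' : eval v (indep_term k) <> \bot by move=> e0; rewrite e0 meet0x in C.
set t := eval v (join_term k) in C; set y := v k in C.
have {IH C'} IH := IH C'.
have tz : t `&` (y `&` kcompl y) = \bot.
  apply: contrapT => tz; apply: C.
  by rewrite /bcompl/= {1}/triv_bcompl; case: eqP => // _; rewrite meet0x meetx0.
have z0 : y `&` kcompl y <> \bot.
  by move=> z0; apply: C; rewrite z0 bcompl_bot bcompl_top !meetx0.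
have [i iz] : exists i, lowb (y `&` kcompl y) i.
  apply: contrapT => noi; apply: z0; apply: hsum_ext => [i||i].
  - by apply/negbTE/negP => iz; apply: noi; exists i.
  - by rewrite hsum_midI mid_kcompl chain_meet_kcompl.
  - rewrite upbI upb_kcompl orbC upb_bot.
    by have [_ [] -> _] := hsum_pow2P y; rewrite ?orbT.
apply: leq_ltn_trans IH _; apply/proper_card/properP; split.
  by apply/fintype.subsetP => j; rewrite !inE /= lowbU => ->.
exists i; first by rewrite inE /= lowbU iz orbT.
rewrite inE -/t; apply/negP => it.
by have := congr1 (fun w => lowb w i) tz; rewrite /= lowbI it iz.
Qed.

End Bound.

(** At most n pairwise disjoint nonzero elements fit below the middle. *)
Lemma indep_bound n e : (e <= 2)%N ->
  satisfies (triv_bz (hs 'I_n e)) (indep_term n.+1) TBot.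
Proof.
move=> e2 v; apply: contrapT => /(card_join_term e2).
by apply/negP; rewrite -ltnNge ltnS (leq_trans (max_card _)) ?card_ord.
Qed.

(** The identity with right-hand side join_term n encodes the inequality
    indep_term n /\ (join_term n)' <= join_term n. *)
Definition fill_term n : bzterm :=
  TJoin (TMeet (indep_term n) (TKcompl (join_term n))) (join_term n).

(** Independence of n half terms makes their join the top of the lower copy,
    which for a one-point middle is the fixed point of the involution. *)
Lemma join_term_fills n :
  satisfies (D2pow_D2pow 'I_n) (fill_term n) (join_term n).
Proof.
move=> v /=; have [->|C] := pselect (eval v (indep_term n) = \bot).
  by rewrite meet0x join0x.
have lT i : lowb (eval v (join_term n)) i.
  have := card_join_term (e := 1) isT C => cn.
  set S := [set _ | _]%SET in cn.
  have ST : S = [set: _]%SET :> {set 'I_n}.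
    by apply/eqP; rewrite eqEcard finset.subsetT cardsT card_ord.
  by have := finset.in_setT i; rewrite -ST inE.
apply: hsum_ext => [i||i].
- by rewrite lowbU lT orbT.
- exact: chain1.
- by rewrite upbU upbI upb_kcompl lT orbT.
Qed.

(** The fibers of a map from I to the numbers are disjoint subsets of I, and
    each number hit by the map gives a nonzero one. *)
Section Attained.
Variables (I : Type) (e m : nat) (g : I -> nat).
Hypothesis g_hits : forall k, (k < m)%N -> exists x, g x = k.

Definition fiber_val (k : nat) : triv_bz (hs I e) :=
  osum_low _ ((fun x => g x == k) : pow2 I).

Local Notation v := fiber_val.

Let lowv k x : lowb (v k) x = (g x == k). Proof. by []. Qed.
Let midv k : hsum_mid (v k) = \bot. Proof. by []. Qed.
Let upv k x : upb (v k) x = true. Proof. by []. Qed.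

Let eval_half k : eval v (half_term k) = v k.
Proof.
apply: hsum_ext => [x||x].
- by rewrite lowbI lowb_kcompl upv andbT.
- by rewrite hsum_midI midv meet0x.
- by rewrite upbI upv.
Qed.

Lemma join_term_attained k :
  [/\ forall x, lowb (eval v (join_term k)) x = (g x < k)%N,
      hsum_mid (eval v (join_term k)) = \bot
    & forall x, upb (eval v (join_term k)) x].
Proof.
elim: k => [|k [l md u]]; first by split.
rewrite [eval _ _]/(_ `|` eval v (half_term k)) eval_half; split=> [x||x].
- by rewrite lowbU l lowv ltnS [RHS]leq_eqVlt orbC.
- by rewrite hsum_midU md midv joinxx.
- by rewrite upbU u upv.
Qed.

Lemma indep_term_attained k : (k <= m)%N -> eval v (indep_term k) = \top.
Proof.
elim: k => [//|k IH] km; have [l md u] := join_term_attained k.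
have -> : eval v (indep_term k.+1) = eval v (indep_term k) `&`
    (bcompl (eval v (join_term k) `&` v k) `&` bcompl (bcompl (v k))).
  by rewrite -eval_half.
rewrite IH ?(ltnW km) // meet1x.
rewrite (_ : _ `&` v k = \bot); last first.
  apply: hsum_ext => [x||x].
  - by rewrite lowbI l lowv; case: ltngtP.
  - by rewrite hsum_midI md meet0x.
  - by rewrite upbI u.
rewrite bcompl_bot meet1x (_ : bcompl (v k) = \bot) ?bcompl_bot //.
rewrite /bcompl/= /triv_bcompl; case: eqP => // vk0.
have [x gx] := g_hits km.
by have := congr1 (fun w => lowb w x) vk0; rewrite /= lowv gx eqxx.
Qed.

End Attained.

End SeparatingTerms.

(** * The chain of varieties *)

Section Inclusions.
Local Open Scope order_scope.

Lemma V_BZL_psub_mid n :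
  psubclass (V_BZL (D2pow_D2pow 'I_n)) (V_BZL (D2pow_D2_D2pow 'I_n)).
Proof.
have hits k : (k < n)%N -> exists x : 'I_n, x = k :> nat.
  by move=> kn; exists (Ordinal kn).
apply: V_BZL_psub (@join_term_fills n) _; first exact: V_BZL_collapse_mid.
move=> /(_ (fiber_val 2 val)) /=; rewrite (indep_term_attained 2 hits) // meet1x.
(* The middle coordinate of the join is 0, that of its complement is 1. *)
move=> /(congr1 (@hsum_mid _ _ _ _)); rewrite hsum_midU mid_kcompl.
have [_ -> _] := join_term_attained 2 (val : 'I_n -> nat) n.
by rewrite kcompl_bot join1x => /(congr1 val).
Qed.

(** A map g hitting 0, ..., n expresses that J has more than n elements:
    cut off at n it maps J onto 'I_n plus a point, and its fibers over 0, ..., n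
    refute the bound on independent elements. *)
Lemma V_BZL_psub_pow n (J : Type) (g : J -> nat) :
  (forall k, (k < n.+1)%N -> exists x, g x = k) ->
  psubclass (V_BZL (D2pow_D2_D2pow 'I_n)) (V_BZL (D2pow_D2pow J)).
Proof.
move=> hits; apply: V_BZL_psub (@indep_bound n 2 isT) _.
  apply: (@V_BZL_option_surj _ _ (fun x => insub (g x))) => -[i|].
    have [x gx] := hits i (ltnW (ltn_ord i)).
    by exists x; rewrite gx valK.
  have [x gx] := hits n (ltnSn n).
  by exists x; rewrite gx insubF ?ltnn.
move=> /(_ (fiber_val 1 g)); rewrite (indep_term_attained 1 hits) // => e10.
have [x _] := hits 0 isT.
by have := congr1 (fun w => lowb w x) e10.
Qed.

Lemma V_BZL_DIST_pow (I : Type) : subclass (V_BZL (D2pow_D2_D2pow I)) DIST.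
Proof. by move=> d A /V_BZL_DIST; apply; exact: D2pow_D2_D2pow_DIST. Qed.

Lemma card_le_injective (T U : Type) : ([set: T] #<= [set: U])%card ->
  exists f : T -> U, injective f.
Proof.
move=> /card_leP[f]; exists (fun x => \val (f (to_setT x))) => x y /val_inj.
by move/(inj (f := f)) => /(_ (in_setT _) (in_setT _)) /(congr1 \val).
Qed.

(** Shift a sequence of distinct elements by one step; its first term is freed
    for the extra point. *)
Lemma infinite_option_surj (I : Type) : infinite_set [set: I] ->
  exists g : I -> option I, forall o, exists x, g x = o.
Proof.
move=> /infiniteP /card_le_injective[f fi].
pose g x : option I :=
  if pselect (exists k, f k = x) is left ex then
    (if projT1 (cid ex) is k.+1 then Some (f k) else None)
  else Some x.
have gf k : g (f k) = if k is k'.+1 then Some (f k') else None.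
  rewrite /g; case: pselect => [ex|[]]; last by exists k.
  by case: cid => j /= /fi ->.
exists g => -[x|]; last by exists (f 0); rewrite gf.
have [[k <-]|nx] := pselect (exists k, f k = x); first by exists (f k.+1); rewrite gf.
by exists x; rewrite /g; case: pselect.
Qed.

Lemma V_BZL_infinite (I : Type) : infinite_set [set: I] ->
  eqclass (V_BZL (D2pow_D2pow I)) (V_BZL (D2pow_D2_D2pow I)).
Proof.
move=> /infinite_option_surj[g gs]; split; apply: V_BZL_sub.
  exact: V_BZL_collapse_mid.
exact: V_BZL_option_surj gs.
Qed.

(** An injection f from 'I_n cannot be onto J; send f i to i and the points
    outside the range of f to n. *)
Lemma card_lt_hits n (J : Type) : card_lt 'I_n J ->
  exists g : J -> nat, forall k, (k < n.+1)%N -> exists x, g x = k.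
Proof.
case=> /card_le_injective[f fi] nJ.
have [x0 fx0] : exists x0, forall i, f i <> x0.
  apply: contrapT => fs; apply: nJ.
  have <- : (f @` [set: 'I_n] = [set: J])%classic.
    rewrite predeqE => x; split=> // _; apply: contrapT => nx; apply: fs.
    by exists x => i fi_x; apply: nx; exists i.
  exact: card_image_le.
exists (fun x => if pselect (exists i, f i = x) is left ex
                 then nat_of_ord (projT1 (cid ex)) else n).
move=> k; rewrite ltnS leq_eqVlt => /predU1P[->|kn].
  by exists x0; case: pselect => // -[i fi0]; case: (fx0 i).
exists (f (Ordinal kn)); case: pselect => [ex|[]]; last by exists (Ordinal kn).
by case: cid => i /= /fi ->.
Qed.

End Inclusions.

Theorem theorem3p16 :
  (* (i) *)
  (forall (n : nat) (I : Type), card_lt 'I_n I ->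
     [/\ (V_BZL (D2pow_D2pow 'I_n) <v V_BZL (D2pow_D2_D2pow 'I_n))%bz,
         (V_BZL (D2pow_D2_D2pow 'I_n) <v V_BZL (D2pow_D2pow I))%bz,
         (V_BZL (D2pow_D2pow I) <=v V_BZL (D2pow_D2_D2pow I))%bz
       & (V_BZL (D2pow_D2_D2pow I) <=v DIST)%bz]) /\
  (* (ii) *)
  (forall (n : nat) (I : Type), card_lt 'I_n I -> infinite_set [set: I] ->
     [/\ (V_BZL (D2pow_D2pow 'I_n) <v V_BZL (D2pow_D2_D2pow 'I_n))%bz,
         (V_BZL (D2pow_D2_D2pow 'I_n) <v V_BZL (D2pow_D2pow I))%bz,
         (V_BZL (D2pow_D2pow I) =v V_BZL (D2pow_D2_D2pow I))%bz
       & (V_BZL (D2pow_D2_D2pow I) <=v DIST)%bz]) /\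
  (* the ascending chain *)
  ([/\ (TRIV =v V_BZL (D 1))%bz,
       (V_BZL (D 1) =v V_BZL (D2pow_D2pow 'I_0))%bz,
       (V_BZL (D2pow_D2pow 'I_0) <v BA)%bz,
       (BA =v V_BZL (D 2))%bz
     & (V_BZL (D 2) =v V_BZL (D2pow_D2_D2pow 'I_0))%bz] /\
   [/\ (V_BZL (D2pow_D2_D2pow 'I_0) <v V_BZL (D 3))%bz,
       (V_BZL (D 3) =v V_BZL (D2pow_D2pow 'I_1))%bz,
       (V_BZL (D2pow_D2pow 'I_1) <v V_BZL (D 4))%bz,
       (V_BZL (D 4) =v V_BZL (D2pow_D2_D2pow 'I_1))%bz
     & (V_BZL (D2pow_D2_D2pow 'I_1) <v V_BZL (D2pow_D2pow 'I_2))%bz]) /\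
  (forall n : nat, (2 <= n)%N ->
     [/\ (V_BZL (D2pow_D2pow 'I_n) <v V_BZL (D2pow_D2_D2pow 'I_n))%bz,
         (V_BZL (D2pow_D2_D2pow 'I_n) <v V_BZL (D2pow_D2pow 'I_n.+1))%bz,
         (V_BZL (D2pow_D2pow 'I_n.+1) <v V_BZL (D2pow_D2_D2pow 'I_n.+1))%bz
       & (V_BZL (D2pow_D2_D2pow 'I_n.+1) <v V_BZL (D2pow_D2pow nat))%bz]) /\
  (V_BZL (D2pow_D2pow nat) =v V_BZL (D2pow_D2_D2pow nat))%bz /\
  (V_BZL (D2pow_D2_D2pow nat) <=v DIST)%bz.
Proof.
have step n := V_BZL_psub_pow (J := 'I_n.+1) (g := val)
  (fun k kn => ex_intro _ (Ordinal kn) erefl).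
have D1A := @V_BZL_small_chain 0 0 isT.
have D2B := @V_BZL_small_chain 0 1 isT.
have D3A := @V_BZL_small_chain 1 0 isT.
have D4B := @V_BZL_small_chain 1 1 isT.
have eqr (K : bzclass) : eqclass K K by [].
have eqs (K L : bzclass) : eqclass K L -> eqclass L K by move=> KL d A; apply: iff_sym.
have BA_B0 : eqclass (V_BZL (D2pow_D2_D2pow 'I_0)) BA.
  by move=> d A; rewrite BA_D2; apply: iff_sym; exact: D2B.
have i_part n I : card_lt 'I_n I ->
    [/\ (V_BZL (D2pow_D2pow 'I_n) <v V_BZL (D2pow_D2_D2pow 'I_n))%bz,
        (V_BZL (D2pow_D2_D2pow 'I_n) <v V_BZL (D2pow_D2pow I))%bz,
        (V_BZL (D2pow_D2pow I) <=v V_BZL (D2pow_D2_D2pow I))%bz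
      & (V_BZL (D2pow_D2_D2pow I) <=v DIST)%bz].
  move=> /card_lt_hits[g hits]; split.
  - exact: V_BZL_psub_mid.
  - exact: V_BZL_psub_pow hits.
  - by apply: V_BZL_sub; exact: V_BZL_collapse_mid.
  - exact: V_BZL_DIST_pow.
split; first exact: i_part.
split.
  by move=> n I /i_part[? ? _ ?] I_inf; split=> //; apply: V_BZL_infinite.
split.
  split; split.
  - exact: TRIV_D1.
  - exact: D1A.
  - exact: psubclass_eq (eqr _) BA_B0 (V_BZL_psub_mid 0).
  - exact: BA_D2.
  - exact: D2B.
  - exact: psubclass_eq (eqr _) (eqs _ _ D3A) (step 0).
  - exact: D3A.
  - exact: psubclass_eq (eqr _) (eqs _ _ D4B) (V_BZL_psub_mid 1).
  - exact: D4B.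
  - exact: step.
split.
  move=> n _; split; [exact: V_BZL_psub_mid|exact: step|exact: V_BZL_psub_mid|].
  by apply: (V_BZL_psub_pow (g := id)) => k _; exists k.
by split; [by apply: V_BZL_infinite; exact: infinite_nat|exact: V_BZL_DIST_pow].
Qed.
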